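(* Let $\alpha>0$, $t_0>0$, $x_0\in\mathcal H$, and let $x:[t_0,+\infty)\to\mathcal H$ be a solution of the Cauchy problem $$\tfrac{\alpha}{t}\dot x(t)+\operatorname{proj}_{C(x(t))+\ddot x(t)}(0)=0\ (t>t_0),\qquad x(t_0)=x_0,\ \dot x(t_0)=0 .$$ Assume that every $f_i$ is bounded from below and that the Assumption on the weak Pareto set stated in the context holds. Define $$\mathcal W(t)=u_0(x(t))+\tfrac12\|\dot x(t)\|^2=\sup_{z\in\mathcal H}\min_{i=1,\dots,m}\big(f_i(x(t))-f_i(z)\big)+\tfrac12\|\dot x(t)\|^2 .$$ Then $\lim_{t\to+\infty}\mathcal W(t)=0$. Hence $\lim_{t\to+\infty}u_0(x(t))=0$, and every weak limit point of $x$ is Pareto critical.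
   Context: $\mathcal H$ is a real Hilbert space. $f_1,\dots,f_m:\mathcal H\to\mathbb R$ are convex and continuously differentiable, and $F=(f_1,\dots,f_m)$. $C(x)=\operatorname{co}\{\nabla f_i(x):i=1,\dots,m\}$. For a closed convex $K\subset\mathcal H$, $\operatorname{proj}_K(y)=\arg\min_{w\in K}\|w-y\|^2$. A solution of the Cauchy problem is a function $x:[t_0,+\infty)\to\mathcal H$ such that: $x\in C^1([t_0,+\infty))$; $\dot x$ is absolutely continuous on $[t_0,T]$ for every $T\ge t_0$; there is a Bochner measurable $\ddot x:[t_0,+\infty)\to\mathcal H$ with $\dot x(t)=\dot x(t_0)+\int_{t_0}^t\ddot x(s)\,ds$ for all $t$, and $\frac{d}{dt}\dot x=\ddot x$ a.e.; the equation holds for almost all $t\ge t_0$; and the initial conditions hold. A point $x^*$ is weakly Pareto optimal if there is no $x\in\mathcal H$ with $f_i(x)<f_i(x^* )$ for all $i$; $P_w$ denotes the set of such points. A point $x^*$ is Pareto critical if $0\in C(x^* )$. The merit function is $u_0(x)=\sup_{z\in\mathcal H}\min_{i}\big(f_i(x)-f_i(z)\big)$. For $\hat F\in\mathbb R^m$, $\mathcal L(\hat F)=\{x:F(x)\le\hat F\}$ (componentwise) and $P_w(\hat F)=P_w\cap\mathcal L(\hat F)$. Assumption: for all $x_0\in\mathcal H$ and all $x\in\mathcal L(F(x_0))$ there exists $x^*\in P_w(F(x))$, and $$R:=\sup_{F^*\in F(P_w(F(x_0)))}\ \inf_{x\in F^{-1}(F^* )}\tfrac12\|x-x_0\|^2<+\infty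 .$$ *)

(* Defs.v *)
From HB Require Import structures.
From mathcomp Require Import all_boot all_order all_algebra.
From mathcomp Require Import all_classical all_reals all_analysis.
Set Implicit Arguments. Unset Strict Implicit. Unset Printing Implicit Defensive.
Import Order.TTheory GRing.Theory Num.Theory.
Import numFieldNormedType.Exports.
Local Open Scope classical_set_scope.
Local Open Scope ring_scope.

Section Defs.
Variable R : realType.

(* A real Hilbert space: a complete normed space over R whose norm is induced
   by the inner product [ip]. *)
Definition inner_product (H : normedModType R) (ip : H -> H -> R) : Prop :=
  [/\ (forall x y, ip x y = ip y x),
      (forall (a : R) (x y z : H), ip (a *: x + y) z = a * ip x z + ip y z)
    & (forall x, ip x x = `|x| ^+ 2)].

Variable H : normedModType R.

Definition convex_fun (f : H -> R) : Prop :=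
  forall (x y : H) (l : R), 0 <= l <= 1 ->
    f (l *: x + (1 - l) *: y) <= l * f x + (1 - l) * f y.

Definition has_gradient (ip : H -> H -> R) (f : H -> R) (g : H -> H) : Prop :=
  forall x : H, forall e : R, 0 < e -> exists d : R, 0 < d /\
    forall h : H, `|h| < d -> `|f (x + h) - f x - ip (g x) h| <= e * `|h|.

Definition conv_grads (m : nat) (g : 'I_m -> H -> H) (x : H) : set H :=
  [set v | exists l : 'I_m -> R, (forall i, 0 <= l i) /\ \sum_(i < m) l i = 1
           /\ v = \sum_(i < m) l i *: g i x].

Definition shift_set (K : set H) (a : H) : set H := [set k + a | k in K].

(* proj_K(y) = argmin_{w in K} |w - y|^2 (as a set; a singleton for closed
   convex nonempty K) *)
Definition proj_onto (K : set H) (y : H) : set H :=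
  [set p | K p /\ forall w, K w -> `|p - y| ^+ 2 <= `|w - y| ^+ 2].

Definition deriv_from (t0 : R) (u v : R -> H) : Prop :=
  forall t, t0 <= t -> forall e : R, 0 < e -> exists d : R, 0 < d /\
    forall s, t0 <= s -> `|s - t| < d -> `|u s - u t - (s - t) *: v t| <= e * `|s - t|.

Definition abs_cont_on (a b : R) (u : R -> H) : Prop :=
  forall e : R, 0 < e -> exists d : R, 0 < d /\
    forall (n : nat) (l r : 'I_n -> R),
      (forall k, a <= l k /\ l k <= r k /\ r k <= b) ->
      (forall j k, j != k -> r j <= l k \/ r k <= l j) ->
      \sum_(k < n) (r k - l k) < d ->
      \sum_(k < n) `|u (r k) - u (l k)| < e.

Variable m : nat.
Variable f : 'I_m -> H -> R.

Definition weak_pareto (xs : H) : Prop := ~ exists x, forall i, f i x < f i xs.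

Definition pareto_critical (g : 'I_m -> H -> H) (xs : H) : Prop :=
  conv_grads g xs 0.

Definition level_set (Fh : 'I_m -> R) : set H := [set x | forall i, f i x <= Fh i].

Definition weak_pareto_level (Fh : 'I_m -> R) : set H :=
  [set x | weak_pareto x /\ level_set Fh x].

Definition Fval (x : H) : 'I_m -> R := fun i => f i x.

Definition merit_u0 (x : H) : \bar R :=
  ereal_sup [set \big[mine/+oo%E]_(i < m) ((f i x - f i z)%:E) | z in [set: H]].

Definition R_const (x0 : H) : \bar R :=
  ereal_sup [set ereal_inf [set ((2^-1) * `|x - x0| ^+ 2)%:E | x in [set x | Fval x = Fs]]
            | Fs in [set Fval z | z in weak_pareto_level (Fval x0)]].

End Defs.

(* Main.v *)
Require Import Defs.
From HB Require Import structures.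
From mathcomp Require Import all_boot all_order all_algebra.
From mathcomp Require Import all_classical all_reals all_analysis.
From mathcomp Require Import lra ring.
Import Order.TTheory GRing.Theory Num.Theory.
Import numFieldNormedType.Exports.
Local Open Scope classical_set_scope.
Local Open Scope ring_scope.

(** Along the trajectory each energy [f i (x t) + |xd t|^2 / 2] decreases, at
    rate at least [(alpha / t) |xd t|^2].  If the Lyapunov function [W] exceeds
    [eps] at some late time [tau], the assumption on the weak Pareto set
    provides a comparison point [z] in a fixed ball around [x0] such that
    [f i (x t) - f i z + |xd t|^2 / 2 >= eps] for all [i] and all [t <= tau].
    Then [h = |x - z|^2 / 2] satisfies
    [h'' + (alpha / t) h' <= 3 / 2 |xd|^2 - eps]; after multiplication by
    [t ^ alpha] the kinetic term is absorbed by the energy, which is nearly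
    constant for large [t].  So [h' <= A - c t] on [[t1, tau]] with [t1], [A]
    and [c > 0] independent of [tau] and [z], and [h] would become negative for
    large [tau].  At a weak limit point the merit function vanishes by weak lower
    semicontinuity, and the element of minimal norm of the convex hull of the
    gradients would otherwise be a common descent direction. *)

Set Implicit Arguments.
Unset Strict Implicit.
Unset Printing Implicit Defensive.

(** * Induction on intervals *)

(** The supremum of the points reachable from [a] is itself reached, and one more interval tagged
    there goes past it unless it is [b]. This form of compactness serves below for monotonicity,
    boundedness and the mean value inequality. *)
Lemma cousin (R : realType) (P : R -> R -> Prop) (a b : R) : a <= b ->
  (forall l c r, l <= c -> c <= r -> P l c -> P c r -> P l r) ->
  (forall t, a <= t <= b -> exists2 d, 0 < d & forall l r,
    a <= l -> l <= t -> t <= r -> r <= b -> t - d < l -> r < t + d -> P l r) ->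
  P a b.
Proof.
move=> ab Pcat Ploc.
pose S := [set c | (a <= c <= b) /\ P a c].
have Sa : S a.
  split; first by rewrite lexx.
  have [|d d0 dP] := Ploc a; first by rewrite lexx.
  by apply: dP => //; lra.
have Sub : has_sup S by split; [exists a|exists b => c [/andP[]]].
have aS : a <= sup S := ub_le_sup Sub.2 Sa.
have Sb : sup S <= b by apply: ge_sup => [|c [/andP[]]]; first exists a.
have [|d d0 dP] := Ploc (sup S); first by rewrite aS.
have [c [/andP[ac cb] Pac] dc] := sup_adherent d0 Sub.
have cS : c <= sup S by apply: ub_le_sup; [exact: Sub.2|split; rewrite ?ac].
pose r := Num.min b (sup S + d / 2).
have rb : r <= b by rewrite ge_min lexx.
have Sr : sup S <= r by rewrite le_min Sb/=; lra.
have rd : r < sup S + d by rewrite gt_min; apply/orP; right; lra.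
have Par : P a r by apply: Pcat (ac) (le_trans cS Sr) Pac _; exact: dP.
suff <- : r = b by [].
have /ub_le_sup : S r by split => //; rewrite rb (le_trans aS).
move=> /(_ Sub.2) rS; move: rS; rewrite /r ge_min => /orP[bS|]; last by lra.
by apply/min_idPl; lra.
Qed.

(** * Monotonicity from a derivative that exists almost everywhere *)

Section abs_cont.
Context {R : realType}.
Let mu : measure _ _ := @lebesgue_measure R.

(** The pointwise form of [deriv_from]: increments are tested only at points [s >= t0], so at [t0]
    itself this is the right derivative. *)
Definition derivative_from (V : normedModType R) (t0 : R) (u : R -> V)
    (t : R) (d : V) : Prop :=
  forall e : R, 0 < e -> exists k : R, 0 < k /\
    forall s, t0 <= s -> `|s - t| < k ->
      `|u s - u t - (s - t) *: d| <= e * `|s - t|.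

(** Sorted lists of intervals can be concatenated, which suits the gluing step of [cousin] better
    than families indexed by ['I_n]. *)
Lemma abs_cont_on_seq (V : normedModType R) (a b : R) (u : R -> V) :
  abs_cont_on a b u ->
  forall e : R, 0 < e -> exists d : R, 0 < d /\ forall s : seq (R * R),
    all (fun p => [&& a <= p.1, p.1 <= p.2 & p.2 <= b]) s ->
    pairwise (fun p q => p.2 <= q.1) s ->
    \sum_(p <- s) (p.2 - p.1) < d -> \sum_(p <- s) `|u p.2 - u p.1| < e.
Proof.
move=> uac e e0; have [d [d0 dP]] := uac e e0; exists d; split=> // s sab sp.
rewrite !(big_nth (0, 0)) !big_mkord => sd.
apply: (dP _ (fun k => (nth (0, 0) s k).1) (fun k => (nth (0, 0) s k).2)) sd.
  by move=> k; have /and3P[] := allP sab _ (mem_nth (0, 0) (ltn_ord k)).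
move=> j k jk; move/(pairwiseP (0, 0)): sp => sp.
have : (j : nat) != k by [].
rewrite neq_ltn => /orP[jk'|kj]; [left|right]; apply: sp => //;
  exact: ltn_ord.
Qed.

(* Cousin's lemma applied to a gauge that makes every interval tagged in the
   exceptional null set lie in an open set of small measure. *)
Lemma abs_cont_nonincreasing (t0 a b : R) (phi : R -> R) :
  t0 <= a -> a <= b -> abs_cont_on a b phi ->
  {ae mu, forall t, a < t < b ->
     exists2 d, derivative_from t0 phi t d & d <= 0} ->
  phi b <= phi a.
Proof.
move=> t0a ab /abs_cont_on_seq phiac [N [mN N0 subN]].
suff small e : 0 < e -> phi b <= phi a + e * (b - a) + e.
  apply/ler_addgt0Pr => e e0.
  have K0 : 0 < 1 + (b - a) by lra.
  have := small (e / (1 + (b - a))) (divr_gt0 e0 K0).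
  suff : e / (1 + (b - a)) * (b - a) + e / (1 + (b - a)) = e by lra.
  by field; lra.
move=> e0; have [k [k0 kP]] := phiac e e0.
(* The derivative is controlled only in the open interval, so both endpoints join the exceptional
   set. *)
pose M := N `|` ([set a] `|` [set b]).
have mM : measurable (M : set (measurableTypeR R)) by do 2?apply: measurableU.
have M0 : mu M = 0%E.
  apply: (iffLR (negligibleP _ mM)); apply: negligibleU; first by exists N; split.
  by apply: negligibleU; apply: (iffRL (negligibleP _ _)) => //;
    exact: lebesgue_measure_set1.
have [|U [oU MU UM]] := @lebesgue_regularity_outer R M k mM _ k0.
  by rewrite M0.
have mU : measurable (U : set (measurableTypeR R)).
  exact: measurable_realfun.open_measurable.
have Uk : (mu U < k%:E)%E.
  apply: le_lt_trans UM; rewrite -{1}(setUIDK U M) setUC.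
  rewrite (le_trans (measureU2 _ _ _))//; first exact: measurableD.
    exact: measurableI.
  rewrite -[leRHS]adde0 leeD2l// -M0 le_measure ?inE//.
  exact: measurableI.
(* Growth at slope at most [e], apart from the increments over a list of disjoint intervals whose
   total length is paid for by [U]. Half-open intervals make this budget exactly additive under
   gluing. *)
pose P l r := exists s : seq (R * R), [/\
  all (fun p => [&& l <= p.1, p.1 <= p.2 & p.2 <= r]) s,
  pairwise (fun p q => p.2 <= q.1) s,
  ((\sum_(p <- s) (p.2 - p.1))%:E <= mu (U `&` `]l, r]))%E &
  phi r - phi l <= e * (r - l) + \sum_(p <- s) `|phi p.2 - phi p.1|].
suff [s [sab sp sU sphi]] : P a b.
  have /(kP s sab sp) : \sum_(p <- s) (p.2 - p.1) < k.
    rewrite -lte_fin (le_lt_trans sU)// (le_lt_trans _ Uk)//.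
    by rewrite le_measure ?inE//; exact: measurableI.
  by lra.
apply: cousin => //.
  move=> l c r lc cr [s [sab sp sU sphi]] [s' [s'ab s'p s'U s'phi]].
  exists (s ++ s'); split.
  - rewrite all_cat; apply/andP; split.
      by apply: sub_all sab => p /and3P[? ? ?]; apply/and3P; split; lra.
    by apply: sub_all s'ab => p /and3P[? ? ?]; apply/and3P; split; lra.
  - rewrite pairwise_cat sp s'p !andbT; apply/allrelP => p q ps qs.
    have /and3P[_ _ ?] := allP sab _ ps; have /and3P[? _ _] := allP s'ab _ qs.
    by lra.
  - rewrite big_cat/= EFinD.
    rewrite (_ : U `&` `]l, r] = (U `&` `]l, c]) `|` (U `&` `]c, r])); last first.
      by rewrite -setIUr -itv_bndbnd_setU.
    rewrite measureU; first exact: leeD.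
    - exact: measurableI.
    - exact: measurableI.
    - apply/seteqP; split => // z [[_ /=]]; rewrite in_itv/= => /andP[_ zc].
      by move=> [_ /=]; rewrite in_itv/= => /andP[]; lra.
  - by rewrite big_cat/=; lra.
move=> t /andP[at_ tb].
have [Mt|nMt] := pselect (M t).
  (* At an exceptional tag the whole interval lies in [U] and becomes the single entry of the list;
     at any other tag the list is empty and the derivative gives the slope. *)
  have /nbhs_ballP[d d0 dU] : nbhs t U by apply: open_nbhs_nbhs; split => //; exact: MU.
  exists d => // l r al lt tr rb tdl rtd; exists [:: (l, r)]; split => //=.
  - by rewrite !lexx/= andbT (le_trans lt).
  - rewrite big_seq1/= (_ : U `&` _ = `]l, r]%classic); last first.
      apply/setIidPr => z /=; rewrite in_itv/= => /andP[lz zr]; apply: dU.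
      by rewrite /ball/= ltr_norml; apply/andP; split; lra.
    rewrite lebesgue_measure_itv/= lte_fin; case: ltP => // rl.
    by rewrite lee_fin; lra.
  - rewrite big_seq1/=; have := ler_norm (phi r - phi l).
    by have := mulr_ge0 (ltW e0) (_ : 0 <= r - l); lra.
have [at'|ta] := eqVneq t a; first by exfalso; apply: nMt; right; left.
have [bt'|tb'] := eqVneq t b; first by exfalso; apply: nMt; right; right.
have tab : a < t < b by rewrite !lt_neqAle at_ tb eq_sym ta tb'.
have [d dphi d0] : exists2 d, derivative_from t0 phi t d & d <= 0.
  by apply: contrapT => nd; apply: nMt; left; apply: subN => /= /(_ tab).
have [k' [k'0 k'P]] := dphi e e0; exists k' => // l r al lt tr rb tdl rtd.
exists [::]; split => //; first by rewrite big_nil measure_ge0.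
rewrite big_nil addr0.
have dr : (r - t) * d <= 0 by apply: mulr_ge0_le0 => //; lra.
have dl : 0 <= (l - t) * d by apply: mulr_le0 => //; lra.
have : `|phi r - phi t - (r - t) * d| <= e * `|r - t|.
  by apply: k'P; [lra|rewrite ltr_norml; apply/andP; split; lra].
have : `|phi l - phi t - (l - t) * d| <= e * `|l - t|.
  by apply: k'P; [lra|rewrite ltr_norml; apply/andP; split; lra].
rewrite (ler0_norm (_ : l - t <= 0)); last by lra.
rewrite (ger0_norm (_ : 0 <= r - t)); last by lra.
by rewrite !ler_norml => /andP[? ?] /andP[? ?]; lra.
Qed.
End abs_cont.

(** * Differentiation rules, and a class of functions inheriting absolute continuity *)

Section calculus.
Context {R : realType}.

(** Covers both the product of reals and the inner product, so that the product rule and the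
    stability of [tame] are proved once. *)
Definition bounded_bilinear (V1 V2 : normedModType R) (B : V1 -> V2 -> R) :=
  [/\ forall a x y z, B (a *: x + y) z = a * B x z + B y z,
      forall a x y z, B z (a *: x + y) = a * B z x + B z y &
      forall x y, `|B x y| <= `|x| * `|y|].

Lemma bounded_bilinear_mul : bounded_bilinear (fun x y : R => x * y).
Proof.
by split=> [a x y z|a x y z|x y]; rewrite ?normrM// /GRing.scale/=; ring.
Qed.

Lemma bounded_bilinearBl (V1 V2 : normedModType R) (B : V1 -> V2 -> R) x y z :
  bounded_bilinear B -> B (x - y) z = B x z - B y z.
Proof. by move=> [Bl _ _]; rewrite addrC -scaleN1r Bl; ring. Qed.

Lemma bounded_bilinearBr (V1 V2 : normedModType R) (B : V1 -> V2 -> R) x y z :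
  bounded_bilinear B -> B z (x - y) = B z x - B z y.
Proof. by move=> [_ Br _]; rewrite addrC -scaleN1r Br; ring. Qed.

Lemma bounded_bilinearZl (V1 V2 : normedModType R) (B : V1 -> V2 -> R) a x z :
  bounded_bilinear B -> B (a *: x) z = a * B x z.
Proof.
move=> Bb; have [Bl _ _] := Bb.
by rewrite -[a *: x]addr0 Bl -(subrr x) (bounded_bilinearBl _ _ _ Bb) subrr addr0.
Qed.

Lemma bounded_bilinearZr (V1 V2 : normedModType R) (B : V1 -> V2 -> R) a x z :
  bounded_bilinear B -> B z (a *: x) = a * B z x.
Proof.
move=> Bb; have [_ Br _] := Bb.
by rewrite -[a *: x]addr0 Br -(subrr x) (bounded_bilinearBr _ _ _ Bb) subrr addr0.
Qed.

Lemma derivative_from_lip (V : normedModType R) t0 (u : R -> V) t d :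
  derivative_from t0 u t d -> forall e, 0 < e -> exists k, 0 < k /\
    forall s, t0 <= s -> `|s - t| < k -> `|u s - u t| <= (`|d| + e) * `|s - t|.
Proof.
move=> du e e0; have [k [k0 kP]] := du e e0; exists k; split=> // s t0s sk.
have := kP s t0s sk; have := ler_normD (u s - u t - (s - t) *: d) ((s - t) *: d).
by rewrite subrK normrZ; lra.
Qed.

Lemma derivative_from_cst (V : normedModType R) t0 (c : V) t :
  derivative_from t0 (fun=> c) t 0.
Proof.
move=> e e0; exists 1; split=> // s _ _.
by rewrite subrr scaler0 subrr normr0 mulr_ge0// ltW.
Qed.

Lemma derivative_from_id t0 (t : R) : derivative_from t0 (@id R) t 1.
Proof.
move=> e e0; exists 1; split=> // s _ _.
by rewrite /GRing.scale/= mulr1 subrr normr0 mulr_ge0// ltW.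
Qed.

Lemma derivative_fromD (V : normedModType R) t0 (u w : R -> V) t d d' :
  derivative_from t0 u t d -> derivative_from t0 w t d' ->
  derivative_from t0 (fun s => u s + w s) t (d + d').
Proof.
move=> du dw e e0; have e20 : 0 < e / 2 by lra.
have [k [k0 kP]] := du _ e20; have [k' [k'0 k'P]] := dw _ e20.
exists (Num.min k k'); split; first by rewrite lt_min k0.
move=> s t0s; rewrite lt_min => /andP[sk sk'].
have := kP _ t0s sk; have := k'P _ t0s sk'.
have -> : u s + w s - (u t + w t) - (s - t) *: (d + d') =
  (u s - u t - (s - t) *: d) + (w s - w t - (s - t) *: d').
  by rewrite scalerDr !opprD [RHS]addrACA; congr (_ + _); rewrite addrACA.
have := ler_normD (u s - u t - (s - t) *: d) (w s - w t - (s - t) *: d').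
by lra.
Qed.

Lemma derivative_from_bilinear (V1 V2 : normedModType R) (B : V1 -> V2 -> R)
    t0 (u : R -> V1) (w : R -> V2) t d d' : bounded_bilinear B ->
  derivative_from t0 u t d -> derivative_from t0 w t d' ->
  derivative_from t0 (fun s => B (u s) (w s)) t (B d (w t) + B (u t) d').
Proof.
move=> Bb du dw e e0; have [Bl Br Bn] := Bb.
(* [M] collects the coefficients of the three error bounds [b1], [b2], [b3] below; the final [1]
   makes it positive. *)
pose M := `|w t| + (`|d'| + 1) + `|d| * (`|d'| + 1) + `|u t| + 1.
have d10 : 0 <= `|d| * (`|d'| + 1) by rewrite mulr_ge0 ?addr_ge0.
have M0 : 0 < M.
  have := normr_ge0 (w t); have := normr_ge0 d'; have := normr_ge0 (u t).
  by rewrite /M; lra.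
pose e1 := Num.min 1 (e / M).
have e10 : 0 < e1 by rewrite lt_min ltr01 divr_gt0.
have e11 : e1 <= 1 by rewrite ge_min lexx.
have e1M : e1 * M <= e by rewrite -ler_pdivlMr// ge_min lexx orbT.
clearbody e1.
have [k1 [k10 k1P]] := du _ e10; have [k2 [k20 k2P]] := dw _ e10.
have [k3 [k30 k3P]] := derivative_from_lip dw ltr01.
exists (Num.min (Num.min k1 e1) (Num.min k2 k3)); split.
  by rewrite !lt_min k10 e10 k20.
move=> s t0s; rewrite !lt_min => /andP[/andP[sk1 se1] /andP[sk2 sk3]].
have := k1P s t0s sk1; have := k2P s t0s sk2; have := k3P s t0s sk3.
set z1 := u s - u t - _; set z2 := w s - w t - _; set z3 := w s - w t.
set S := `|s - t| in se1 sk1 sk2 sk3 *; have S0 : 0 <= S by exact: normr_ge0.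
move=> z3S z2S z1S; rewrite /GRing.scale/=.
(* The remainder splits into the first-order error of [u], a second-order cross term, and the
   first-order error of [w]. *)
have -> : B (u s) (w s) - B (u t) (w t) - (s - t) * (B d (w t) + B (u t) d') =
   B z1 (w s) + (s - t) * B d z3 + B (u t) z2.
  rewrite /z1 /z2 /z3 !(bounded_bilinearBl _ _ _ Bb, bounded_bilinearBr _ _ _ Bb).
  by rewrite (bounded_bilinearZl _ _ _ Bb) (bounded_bilinearZr _ _ _ Bb); ring.
have ws : `|w s| <= `|w t| + (`|d'| + 1).
  have := ler_normD (w s - w t) (w t); rewrite subrK -/z3.
  have : (`|d'| + 1) * S <= (`|d'| + 1) * 1 by rewrite ler_wpM2l ?addr_ge0//; lra.
  by lra.
have b1 : `|B z1 (w s)| <= e1 * S * (`|w t| + (`|d'| + 1)).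
  by apply: le_trans (Bn _ _) _; apply: ler_pM.
have b2 : `|(s - t) * B d z3| <= e1 * S * (`|d| * (`|d'| + 1)).
  rewrite normrM -/S [e1 * S]mulrC -mulrA ler_wpM2l//.
  apply: le_trans (Bn _ _) _; rewrite mulrCA ler_wpM2l//.
  apply: le_trans z3S _; rewrite mulrC ler_wpM2r ?addr_ge0//; lra.
have b3 : `|B (u t) z2| <= e1 * S * `|u t|.
  by apply: le_trans (Bn _ _) _; rewrite mulrC ler_wpM2r.
have := ler_normD (B z1 (w s) + (s - t) * B d z3) (B (u t) z2).
have := ler_normD (B z1 (w s)) ((s - t) * B d z3).
have : e1 * S * M <= e * S by rewrite mulrAC ler_wpM2r.
have : 0 <= e1 * S by rewrite mulr_ge0// ltW.
by rewrite {1}/M; lra.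
Qed.

Lemma derivative_fromM t0 (u w : R -> R) t d d' :
  derivative_from t0 u t d -> derivative_from t0 w t d' ->
  derivative_from t0 (fun s => u s * w s) t (d * w t + u t * d').
Proof. exact: derivative_from_bilinear bounded_bilinear_mul. Qed.

Lemma derivative_fromZ t0 (c : R) (u : R -> R) t d :
  derivative_from t0 u t d -> derivative_from t0 (fun s => c * u s) t (c * d).
Proof.
move=> /(derivative_fromM (derivative_from_cst t0 (c : R) t)).
by rewrite mul0r add0r.
Qed.

Lemma is_derive_derivative_from (V : normedModType R) (t0 t : R) (u : R -> V) d :
  is_derive t (1 : R) u d -> derivative_from t0 u t d.
Proof.
move=> [du <-] e e0.
have /cvgrPdist_le/(_ e e0) := du.
rewrite -[lim _]/('D_1 u t) => /nbhs_ballP[k /= k0 kP].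
exists k; split=> // s _ sk; have [->|st] := eqVneq s t.
  by rewrite !subrr scale0r subr0 !normr0 mulr0.
have st0 : s - t != 0 by rewrite subr_eq0.
have /= := kP (s - t); rewrite /ball/= sub0r normrN => /(_ sk st0).
rewrite [_ *: 1]mulr1 subrK distrC => h.
rewrite -[u s - u t](scalerKV st0) -scalerBr normrZ mulrC.
by rewrite ler_wpM2r.
Qed.

Definition locally_bounded (V : normedModType R) t0 (u : R -> V) :=
  forall b, exists M, forall t, t0 <= t <= b -> `|u t| <= M.

Definition continuous_from (V : normedModType R) t0 (u : R -> V) :=
  forall t, t0 <= t -> forall e, 0 < e -> exists k, 0 < k /\
    forall s, t0 <= s -> `|s - t| < k -> `|u s - u t| < e.

Lemma deriv_from_continuous_from (V : normedModType R) t0 (u v : R -> V) :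
  deriv_from t0 u v -> continuous_from t0 u.
Proof.
move=> duv t t0t e e0.
have [k [k0 kP]] := derivative_from_lip (duv t t0t) ltr01.
have L0 : 0 < `|v t| + 1 by have := normr_ge0 (v t); lra.
exists (Num.min k (e / (`|v t| + 1))); split; first by rewrite lt_min k0 divr_gt0.
move=> s t0s; rewrite lt_min => /andP[/(kP s t0s) h].
by rewrite ltr_pdivlMr// mulrC; apply: le_lt_trans.
Qed.

Lemma continuous_from_comp (V W : normedModType R) t0 (u : R -> V) (g : V -> W) :
  continuous_from t0 u -> continuous g -> continuous_from t0 (g \o u).
Proof.
move=> cu cg t t0t e e0.
have /cvgrPdist_lt/(_ e e0)/nbhs_ballP[k /= k0 kP] := cg (u t).
have [k' [k'0 k'P]] := cu t t0t k k0; exists k'; split=> // s t0s sk.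
by rewrite distrC; apply: kP; rewrite -ball_normE/= distrC; exact: k'P.
Qed.

(** Continuity bounds [u] near each tag, and [cousin] glues the bounds by taking maxima. *)
Lemma continuous_from_locally_bounded (V : normedModType R) t0 (u : R -> V) :
  continuous_from t0 u -> locally_bounded t0 u.
Proof.
move=> cu b; have [t0b|bt0] := leP t0 b; last first.
  by exists 0 => t /andP[? ?]; exfalso; lra.
apply: (@cousin R (fun l r => exists M, forall t, l <= t <= r -> `|u t| <= M)) => //.
  move=> l c r _ _ [M MP] [M' M'P]; exists (Num.max M M') => t /andP[lt tr].
  rewrite le_max; apply/orP; have [tc|ct] := leP t c; [left|right].
    by apply: MP; rewrite lt.
  by apply: M'P; rewrite (ltW ct).
move=> t /andP[t0t tb]; have [k [k0 kP]] := cu t t0t 1 ltr01; exists k => //.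
move=> l r t0l lt tr rb tkl rtk; exists (`|u t| + 1) => s /andP[ls sr].
have : `|u s - u t| < 1.
  by apply: kP; [lra|rewrite ltr_norml; apply/andP; split; lra].
by have := ler_normD (u s - u t) (u t); rewrite subrK; lra.
Qed.

Lemma abs_cont_continuous_from (V : normedModType R) t0 (u : R -> V) :
  (forall T, t0 <= T -> abs_cont_on t0 T u) -> continuous_from t0 u.
Proof.
move=> uac t t0t e e0.
have t0t1 : t0 <= t + 1 by lra.
have [d [d0 dP]] := abs_cont_on_seq (uac _ t0t1) e0.
exists (Num.min d 1); split; first by rewrite lt_min d0 ltr01.
move=> s t0s; rewrite lt_min ltr_norml ltr_norml => /andP[/andP[? ?] /andP[? ?]].
have [st|/ltW ts] := leP s t.
  have := dP [:: (s, t)]; rewrite /= !big_seq1/= distrC t0s st; apply => //; lra.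
by have := dP [:: (t, s)]; rewrite /= !big_seq1/= t0t ts; apply => //; lra.
Qed.

(** A mean value inequality for vector-valued functions, obtained by gluing local estimates with
    [cousin]. The [+ 1] is the tolerance of these local estimates. *)
Lemma deriv_from_lipschitz (V : normedModType R) t0 b M (u v : R -> V) :
  deriv_from t0 u v -> (forall t, t0 <= t <= b -> `|v t| <= M) ->
  forall l r, t0 <= l -> l <= r -> r <= b -> `|u r - u l| <= (M + 1) * (r - l).
Proof.
move=> duv vM l r t0l lr rb.
apply: (@cousin R (fun l r => `|u r - u l| <= (M + 1) * (r - l))) => //.
  move=> x y z _ _; have := ler_normD (u z - u y) (u y - u x).
  by rewrite addrA subrK; lra.
move=> t /andP[lt tr]; have t0t : t0 <= t by lra.
have [k [k0 kP]] := derivative_from_lip (duv t t0t) ltr01; exists k => //.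
move=> x y lx xt ty yr tkx ytk.
have Mt : `|v t| <= M by apply: vM; apply/andP; split; lra.
have : `|u y - u t| <= (`|v t| + 1) * `|y - t|.
  by apply: kP; [lra|rewrite ltr_norml; apply/andP; split; lra].
have : `|u x - u t| <= (`|v t| + 1) * `|x - t|.
  by apply: kP; [lra|rewrite ltr_norml; apply/andP; split; lra].
rewrite (ger0_norm (_ : 0 <= y - t)) ?(ler0_norm (_ : x - t <= 0)); try lra.
have := ler_normD (u y - u t) (u t - u x).
rewrite addrA subrK (distrC (u t)).
have : (`|v t| + 1) * - (x - t) <= (M + 1) * - (x - t) by rewrite ler_wpM2r; lra.
have : (`|v t| + 1) * (y - t) <= (M + 1) * (y - t) by rewrite ler_wpM2r; lra.
by lra.
Qed.

(* On a compact interval this class is stable under products, contains [u] and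
   the functions with bounded derivative, and inherits absolute continuity. *)
Definition tame (V W : normedModType R) a b (u : R -> V) (w : R -> W) :=
  exists L, [/\ 0 <= L, forall t, a <= t <= b -> `|w t| <= L &
    forall l r, a <= l -> l <= r -> r <= b ->
      `|w r - w l| <= L * (r - l + `|u r - u l|)].

Lemma tame_abs_cont (V W : normedModType R) a b (u : R -> V) (w : R -> W) :
  abs_cont_on a b u -> tame a b u w -> abs_cont_on a b w.
Proof.
move=> uac [L [L0 _ Lw]] e e0.
(* The lengths and the increments of [u] will each sum to less than [e / (2 * (L + 1))]; using
   [L + 1] covers the case [L = 0]. *)
have K0 : 0 < 2 * (L + 1) by lra.
have eK0 := divr_gt0 e0 K0.
have [d [d0 dP]] := uac _ eK0.
exists (Num.min d (e / (2 * (L + 1)))); split; first by rewrite lt_min d0.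
move=> n l r lrab lrdis; rewrite lt_min => /andP[/(dP n l r lrab lrdis) ud le].
apply: (@le_lt_trans _ _ (\sum_(k < n) L * (r k - l k + `|u (r k) - u (l k)|))).
  by apply: ler_sum => k _; have [? [? ?]] := lrab k; exact: Lw.
rewrite -mulr_sumr big_split/=.
apply: (@le_lt_trans _ _ (L * (2 * (e / (2 * (L + 1)))))).
  by rewrite ler_wpM2l//; lra.
rewrite (_ : L * _ = e * (L / (L + 1))); last by field; lra.
by rewrite gtr_pMr// ltr_pdivrMr; lra.
Qed.

Lemma tame_self (V : normedModType R) t0 b (u : R -> V) :
  locally_bounded t0 u -> tame t0 b u u.
Proof.
move=> /(_ b)[M MP]; exists (Num.max M 1); split.
- by rewrite le_max ler01 orbT.
- by move=> t /MP tM; rewrite le_max tM.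
- move=> l r _ lr _.
  have : 1 * (r - l + `|u r - u l|) <= Num.max M 1 * (r - l + `|u r - u l|).
    apply: ler_wpM2r; first by rewrite addr_ge0// subr_ge0.
    by rewrite le_max lexx orbT.
  by apply: le_trans; lra.
Qed.

Lemma tame_deriv_from (V W : normedModType R) t0 b (u : R -> V) (w v : R -> W) :
  deriv_from t0 w v -> locally_bounded t0 v -> tame t0 b u w.
Proof.
move=> dw /(_ b)[M MP].
have [M' M'P] := continuous_from_locally_bounded (deriv_from_continuous_from dw) b.
have L1 : M' <= Num.max (Num.max M' (M + 1)) 0 by rewrite !le_max lexx.
have L2 : M + 1 <= Num.max (Num.max M' (M + 1)) 0 by rewrite !le_max lexx orbT.
have L3 : 0 <= Num.max (Num.max M' (M + 1)) 0 by rewrite le_max lexx orbT.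
move: (Num.max _ _) L1 L2 L3 => L L1 L2 L3; exists L; split=> //.
  by move=> t /M'P h; lra.
move=> l r t0l lr rb; have := deriv_from_lipschitz dw MP t0l lr rb.
have : (M + 1) * (r - l) <= L * (r - l) by rewrite ler_wpM2r ?subr_ge0.
have : 0 <= L * `|u r - u l| by rewrite mulr_ge0.
by lra.
Qed.

Lemma tameD (V W : normedModType R) a b (u : R -> V) (w w' : R -> W) :
  tame a b u w -> tame a b u w' -> tame a b u (fun t => w t + w' t).
Proof.
move=> [L [L0 wL Lw]] [L' [L'0 wL' Lw']]; exists (L + L'); split.
- exact: addr_ge0.
- move=> t tab; have := wL t tab; have := wL' t tab.
  by have := ler_normD (w t) (w' t); lra.
- move=> l r al lr rb; have := Lw l r al lr rb; have := Lw' l r al lr rb.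
  have := ler_normD (w r - w l) (w' r - w' l).
  by rewrite opprD addrACA; lra.
Qed.

Lemma tame_bilinear (V V1 V2 : normedModType R) (B : V1 -> V2 -> R) a b
    (u : R -> V) (w : R -> V1) (w' : R -> V2) : bounded_bilinear B ->
  tame a b u w -> tame a b u w' -> tame a b u (fun t => B (w t) (w' t)).
Proof.
move=> Bb [L [L0 wL Lw]] [L' [L'0 wL' Lw']]; exists (2 * (L * L')).
have LL' : 0 <= L * L' by exact: mulr_ge0.
have [_ _ Bn] := Bb; split; first by lra.
  move=> t tab; apply: le_trans (Bn _ _) _.
  by have := ler_pM _ _ (wL t tab) (wL' t tab); rewrite !normr_ge0 => /(_ isT isT); lra.
move=> l r al lr rb; set D := r - l + _.
have rab : a <= r <= b by apply/andP; split; lra.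
have lab : a <= l <= b by apply/andP; split; lra.
have -> : B (w r) (w' r) - B (w l) (w' l) =
    B (w r - w l) (w' r) + B (w l) (w' r - w' l).
  by rewrite (bounded_bilinearBl _ _ _ Bb) (bounded_bilinearBr _ _ _ Bb); ring.
have b1 : `|B (w r - w l) (w' r)| <= L * D * L'.
  by apply: le_trans (Bn _ _) _; apply: ler_pM => //; [exact: Lw|exact: wL'].
have b2 : `|B (w l) (w' r - w' l)| <= L * (L' * D).
  by apply: le_trans (Bn _ _) _; apply: ler_pM => //; [exact: wL|exact: Lw'].
have := ler_normD (B (w r - w l) (w' r)) (B (w l) (w' r - w' l)).
by lra.
Qed.

Lemma tame_cst (V W : normedModType R) a b (u : R -> V) (c : W) :
  tame a b u (fun=> c).
Proof.
exists `|c|; split=> // l r _ lr _.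
by rewrite subrr normr0 mulr_ge0// addr_ge0// subr_ge0.
Qed.

Lemma tame_id (V : normedModType R) t0 b (u : R -> V) : tame t0 b u (@id R).
Proof.
apply: (@tame_deriv_from V R t0 b u id (fun=> 1)).
  by move=> ? _; exact: derivative_from_id.
by move=> c; exists 1 => ? _; rewrite normr1.
Qed.

End calculus.

(** * Inner products, gradients of convex functions, and projections *)

Section hilbert.
Context {R : realType} {H : normedModType R} {ip : H -> H -> R}.
Context (ipP : inner_product ip).

Lemma ipC x y : ip x y = ip y x. Proof. by have [] := ipP. Qed.

Lemma ip_norm x : ip x x = `|x| ^+ 2. Proof. by have [] := ipP. Qed.

Lemma ipDl x y z : ip (x + y) z = ip x z + ip y z.
Proof. by have [_ ipl _] := ipP; rewrite -[x]scale1r ipl mul1r scale1r. Qed.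

Lemma ip0l z : ip 0 z = 0.
Proof. by have := ipDl 0 0 z; rewrite addr0; lra. Qed.

Lemma ipZl a x z : ip (a *: x) z = a * ip x z.
Proof. by have [_ ipl _] := ipP; rewrite -[a *: x]addr0 ipl ip0l addr0. Qed.

Lemma ipBl x y z : ip (x - y) z = ip x z - ip y z.
Proof. by rewrite ipDl -scaleN1r ipZl mulN1r. Qed.

Lemma ipDr x y z : ip z (x + y) = ip z x + ip z y.
Proof. by rewrite !(ipC z) ipDl. Qed.

Lemma ipZr a x z : ip z (a *: x) = a * ip z x.
Proof. by rewrite !(ipC z) ipZl. Qed.

Lemma ipBr x y z : ip z (x - y) = ip z x - ip z y.
Proof. by rewrite !(ipC z) ipBl. Qed.

Lemma ip_suml n (l : 'I_n -> R) (v : 'I_n -> H) z :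
  ip (\sum_(i < n) l i *: v i) z = \sum_(i < n) l i * ip (v i) z.
Proof.
elim/big_ind2 : _ => [|x a y b <- <-|i _]; [exact: ip0l|exact: ipDl|exact: ipZl].
Qed.

Lemma norm_add_scale x y s :
  `|x + s *: y| ^+ 2 = `|x| ^+ 2 + 2 * s * ip x y + s ^+ 2 * `|y| ^+ 2.
Proof.
by rewrite -!ip_norm !(ipDl, ipDr, ipZl, ipZr) (ipC y x); ring.
Qed.

Lemma cauchy_schwarz x y : `|ip x y| <= `|x| * `|y|.
Proof.
have [->|x0] := eqVneq x 0; first by rewrite ip0l !normr0 mul0r.
have [->|y0] := eqVneq y 0; first by rewrite ipC ip0l !normr0 mulr0.
have xy0 : 0 < `|x| * `|y| by rewrite mulr_gt0// normr_gt0.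
(* The squared norm expanded here equals [2 * |x| * |y| * (|x| * |y| + s * ip x y)]; the signs
   [s = 1] and [s = -1] give the two halves. *)
have h s : s ^+ 2 = 1 -> 0 <= `|x| * `|y| + s * ip x y.
  move=> s1; have := sqr_ge0 (`|(`|y| *: x) + (s * `|x|) *: y|).
  rewrite norm_add_scale normrZ normr_id ipZl !exprMn s1 => h.
  by rewrite -(pmulr_rge0 _ xy0); lra.
by rewrite ler_norml; apply/andP; split; [have := h 1|have := h (-1)];
  rewrite ?expr1n ?sqrrN ?expr1n => /(_ erefl); lra.
Qed.

Lemma young x y : ip x y <= 2^-1 * `|x| ^+ 2 + 2^-1 * `|y| ^+ 2.
Proof. by have := sqr_ge0 (`|x + (-1) *: y|); rewrite norm_add_scale; lra. Qed.

Lemma bounded_bilinear_ip : bounded_bilinear ip.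
Proof.
split=> [a x y z|a x y z|]; [by rewrite ipDl ipZl|by rewrite ipDr ipZr|].
exact: cauchy_schwarz.
Qed.

Lemma derivative_from_grad (f : H -> R) g t0 (x : R -> H) t d :
  has_gradient ip f g -> derivative_from t0 x t d ->
  derivative_from t0 (f \o x) t (ip (g (x t)) d).
Proof.
move=> fg dx e e0.
(* The tolerance is shared between the remainder of [f], taken at an increment of length at most
   [(|d| + 1) * |s - t|], and the remainder of [x], amplified by the norm of the gradient. *)
have M0 : 0 < `|d| + 1 + `|g (x t)| by rewrite ltr_wpDr// ltr_wpDl.
have eM0 := divr_gt0 e0 M0.
have [d1 [d10 d1P]] := fg (x t) _ eM0.
have [k1 [k10 k1P]] := dx _ eM0.
have [k2 [k20 k2P]] := derivative_from_lip dx ltr01.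
have L0 : 0 < `|d| + 1 by rewrite ltr_wpDl.
exists (Num.min (Num.min k1 k2) (d1 / (`|d| + 1))); split.
  by rewrite !lt_min k10 k20 divr_gt0.
move=> s t0s; rewrite !lt_min => /andP[/andP[/(k1P s t0s) h1 /(k2P s t0s) h2]].
rewrite ltr_pdivlMr// mulrC => h3.
have := d1P (x s - x t) (le_lt_trans h2 h3); rewrite (addrC (x t)) subrK => h4.
rewrite -[_ *: ip _ _]/((s - t) * ip _ _) -ipZr.
have h5 := cauchy_schwarz (g (x t)) (x s - x t - (s - t) *: d).
rewrite ipBr in h5.
have := ler_normD (f (x s) - f (x t) - ip (g (x t)) (x s - x t))
  (ip (g (x t)) (x s - x t) - ip (g (x t)) ((s - t) *: d)).
rewrite addrA subrK /= => h6; apply: le_trans h6 _.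
have -> : e * `|s - t| = e / (`|d| + 1 + `|g (x t)|) * ((`|d| + 1) * `|s - t|)
    + `|g (x t)| * (e / (`|d| + 1 + `|g (x t)|) * `|s - t|).
  by field; lra.
apply: lerD.
  by apply: le_trans h4 _; rewrite ler_wpM2l// ltW.
by apply: le_trans h5 _; rewrite ler_wpM2l.
Qed.

(** Convexity on a short segment from [x] towards [z] is compared with the first-order expansion at
    [x], then divided by the step length [s]. *)
Lemma convex_grad_le (f : H -> R) g x z : convex_fun f -> has_gradient ip f g ->
  f x + ip (g x) (z - x) <= f z.
Proof.
move=> cf fg; apply/ler_addgt0Pr => e e0.
have N0 : 0 < `|z - x| + 1 by rewrite ltr_wpDl.
have [d [d0 dP]] := fg x _ (divr_gt0 e0 N0).
pose s := Num.min 1 (d / (2 * (`|z - x| + 1))).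
have s0 : 0 < s by rewrite lt_min ltr01 divr_gt0// mulr_gt0.
have s1 : s <= 1 by rewrite ge_min lexx.
have sd : s * `|z - x| < d.
  have : s * (2 * (`|z - x| + 1)) <= d.
    by rewrite -ler_pdivlMr ?mulr_gt0// ge_min lexx orbT.
  have : s * (2 * (`|z - x| + 1)) = s * `|z - x| + s * (`|z - x| + 2) by ring.
  have : 0 < s * (`|z - x| + 2) by apply: mulr_gt0 => //; rewrite ltr_wpDl.
  by lra.
have := dP (s *: (z - x)); rewrite normrZ gtr0_norm// => /(_ sd).
have /(cf z x) : 0 <= s <= 1 by rewrite s1 ltW.
have -> : s *: z + (1 - s) *: x = x + s *: (z - x).
  by rewrite scalerBl scale1r scalerBr addrCA.
rewrite ipZr ler_norml => h1 /andP[h2 _].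
have h3 : s * (f x + ip (g x) (z - x)) <= s * f z + s * (e / (`|z - x| + 1) * `|z - x|).
  by move: h1 h2; rewrite [e / _ * (s * _)]mulrCA; lra.
rewrite -mulrDr ler_pM2l// in h3; apply: le_trans h3 _; rewrite lerD2l.
by rewrite mulrAC ler_pdivrMr// ler_wpM2l ?(ltW e0)//; lra.
Qed.

Definition convex_set_of (K : set H) :=
  forall p q s, 0 <= s <= 1 -> K p -> K q -> K (p + s *: (q - p)).

(** The variational inequality of the projection: were the product negative, a small move from [p]
    towards [q] would shorten [p]. *)
Lemma proj_onto0_ge (K : set H) p q :
  convex_set_of K -> proj_onto K 0 p -> K q -> 0 <= ip p (q - p).
Proof.
move=> Kc [Kp pmin] Kq; rewrite leNgt; apply/negP => neg.
set a := ip p (q - p) in neg *; set b := `|q - p| ^+ 2.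
have b0 : 0 <= b by exact: sqr_ge0.
(* The move changes the squared norm by [s * (2 * a + s * b)], and [s * (b + 1) <= - a] makes the
   bracket at most [a - s < 0]. *)
pose s := Num.min 1 (- a / (b + 1)).
have b10 : 0 < b + 1 by lra.
have s0 : 0 < s by rewrite lt_min ltr01 divr_gt0//; lra.
have s1 : s <= 1 by rewrite ge_min lexx.
have sb : s * (b + 1) <= - a by rewrite -ler_pdivlMr// ge_min lexx orbT.
have := pmin (p + s *: (q - p)); rewrite !subr0 norm_add_scale -/a -/b.
have s01 : 0 <= s <= 1 by rewrite s1 ltW.
move=> /(_ (Kc _ _ _ s01 Kp Kq)) h.
have : s * (2 * a + s * b) < 0 by rewrite pmulr_rlt0//; lra.
by lra.
Qed.

Lemma conv_grads_convex m (g : 'I_m -> H -> H) x : convex_set_of (conv_grads g x).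
Proof.
move=> _ _ s /andP[s0 s1] [l [l0 [l1 ->]]] [l' [l'0 [l'1 ->]]].
exists (fun i => l i + s * (l' i - l i)); split=> [i|].
  have -> : l i + s * (l' i - l i) = (1 - s) * l i + s * l' i by ring.
  by rewrite addr_ge0// mulr_ge0//; lra.
split.
  by rewrite big_split/= -mulr_sumr sumrB l1 l'1; ring.
rewrite -sumrB scaler_sumr -big_split/=; apply: eq_bigr => i _.
by rewrite scalerDl -scalerBl scalerA.
Qed.

Lemma shift_set_convex K a : convex_set_of K -> convex_set_of (shift_set K a).
Proof.
move=> Kc _ _ s s01 [p Kp <-] [q Kq <-]; exists (p + s *: (q - p)); first exact: Kc.
have -> : q + a - (p + a) = q - p by rewrite opprD addrACA subrr addr0.
by rewrite addrAC.
Qed.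

Lemma conv_grads_vertex m (g : 'I_m -> H -> H) x i : conv_grads g x (g i x).
Proof.
exists (fun j => (j == i)%:R); split=> [j|]; first by rewrite ler0n.
rewrite (bigD1 i)//= eqxx big1 ?addr0; last by move=> j /negbTE ->.
by rewrite (bigD1 i)//= eqxx scale1r big1 ?addr0// => j /negbTE ->; rewrite scale0r.
Qed.
End hilbert.

(** * The merit function and convergence to zero in the extended reals *)

Section merit.
Context {R : realType} {H : normedModType R} {m : nat} (f : 'I_m -> H -> R).

Lemma merit_u0_ge x z (a : R) :
  (forall i, a <= f i x - f i z) -> (a%:E <= merit_u0 f x)%E.
Proof.
move=> az; apply: (@le_trans _ _ (\big[mine/+oo%E]_(i < m) ((f i x - f i z)%:E))%E).
  by apply: le_bigmin => [|i _]; rewrite ?leey// lee_fin.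
by apply: ereal_sup_ubound; exists z.
Qed.

Lemma merit_u0_gt x (a : R) :
  (a%:E < merit_u0 f x)%E -> exists z, forall i, a < f i x - f i z.
Proof.
move=> /ereal_sup_gt[_ [z _ <-]] /bigmin_gtP[_ az].
by exists z => i; rewrite -lte_fin; exact: az.
Qed.

Lemma merit_u0_ge0 x : (0 <= merit_u0 f x)%E.
Proof. by apply: (@merit_u0_ge x x) => i; rewrite subrr. Qed.
End merit.

Lemma cvge0_pinfty (R : realType) (F : R -> \bar R) :
  (forall t, 0 <= F t)%E ->
  (forall e, 0 < e -> exists T, forall t, T <= t -> (F t <= e%:E)%E) ->
  F @ +oo --> 0%E.
Proof.
move=> F0 Fe.
have Ffin e T : (forall t, T <= t -> (F t <= e%:E)%E) ->
    forall t, T <= t -> F t \is a fin_num.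
  by move=> h t Tt; rewrite ge0_fin_numE// (le_lt_trans (h t Tt))// ltry.
apply/fine_cvgP; split.
  have [T TP] := Fe 1 ltr01; exists T; split=> [|t /ltW]; first exact: num_real.
  exact: (Ffin 1 T).
apply/cvgrPdist_le => e e0; have [T TP] := Fe e e0.
exists T; split=> [|t /ltW Tt]; first exact: num_real.
rewrite sub0r normrN ger0_norm/= ?fine_ge0// -lee_fin fineK ?TP//.
exact: Ffin TP _ Tt.
Qed.

(** * Weak Pareto optimality, criticality and weak limits *)

Section pareto.
Context {R : realType} {H : normedModType R} {ip : H -> H -> R}.
Context (ipP : inner_product ip) {m : nat} (f : 'I_m -> H -> R) (g : 'I_m -> H -> H).

(** The norm of the combination is a continuous function of the coefficients, and the simplex of
    coefficients is compact. *)
Lemma conv_grads_min_norm x : (0 < m)%N -> exists p, proj_onto (conv_grads g x) 0 p.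
Proof.
move=> m0.
pose A := [set v : 'rV[R]_m | forall i, `[0, 1]%classic (v ord0 i)] `&`
          [set v : 'rV[R]_m | \sum_(i < m) v ord0 i = 1].
have comb_ct (V : normedModType R) (v : 'I_m -> V) :
    continuous (fun l : 'rV[R]_m => \sum_(i < m) l ord0 i *: v i).
  apply: continuous_big => [|i _ l]; first exact: add_continuous.
  exact: (cvgZr_tmp (@coord_continuous R _ _ ord0 i l)).
have Acpt : compact A.
  apply: compact_closedI.
    by apply: (@rV_compact R m (fun=> `[0, 1]%classic)) => i; exact: segment_compact.
  (* The sum of the coefficients is read as a combination of the vectors [1 : R], so that [comb_ct]
     gives its continuity. *)
  rewrite (_ : [set v | _] =
    (fun l : 'rV[R]_m => \sum_(i < m) l ord0 i *: (1 : R)) @^-1` [set 1]).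
    by apply: preimage_closed; [move=> ? _; exact: comb_ct|exact: closed_eq].
  apply: eq_set => v /=; congr (_ = 1); apply: eq_bigr => i _.
  by rewrite /GRing.scale/= mulr1.
have [||c /set_mem[c01 c1] cmin] :=
    @EVT_min_rV R m (fun l => `|\sum_(i < m) l ord0 i *: g i x|) A _ Acpt.
- exists (delta_mx ord0 (Ordinal m0)); split=> [i|].
    by rewrite /= mxE in_itv/= ler0n lern1 leq_b1.
  rewrite /= (bigD1 (Ordinal m0))//= mxE !eqxx big1 ?addr0// => i /negbTE i0.
  by rewrite mxE i0 andbF.
- apply: continuous_subspaceT => l.
  exact: (cvg_norm (comb_ct _ (fun i => g i x) l)).
have c0 i : 0 <= c ord0 i by have := c01 i; rewrite /= in_itv/= => /andP[].
exists (\sum_(i < m) c ord0 i *: g i x); split; first by exists (c ord0).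
move=> _ [l [l0 [l1 ->]]]; rewrite !subr0 lerXn2r ?nnegrE//.
pose v : 'rV[R]_m := \row_i l i.
have vl : \sum_(i < m) v ord0 i *: g i x = \sum_(i < m) l i *: g i x.
  by apply: eq_bigr => i _; rewrite mxE.
rewrite -vl; apply: cmin; rewrite inE; split=> [i|] /=; last first.
  by rewrite -[RHS]l1; apply: eq_bigr => i _; rewrite mxE.
rewrite mxE in_itv/= l0/= -l1 (bigD1 i)//= lerDl.
exact: sumr_ge0.
Qed.

(** If the element [p] of minimal norm is nonzero, the variational inequality at each vertex gives
    [ip (g i x) p >= |p|^2], so [- p] is a descent direction for every [f i]. *)
Lemma weak_pareto_critical x : (0 < m)%N ->
  (forall i, has_gradient ip (f i) (g i)) -> weak_pareto f x ->
  pareto_critical g x.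
Proof.
move=> m0 fg wp; have [p pp] := conv_grads_min_norm x m0.
have [p0|p0] := eqVneq p 0; first by rewrite /pareto_critical -p0; exact: pp.1.
exfalso; apply: wp; have np0 : 0 < `|p| by rewrite normr_gt0.
have np20 : 0 < `|p| / 2 by lra.
have pg i : `|p| ^+ 2 <= ip (g i x) p.
  have := proj_onto0_ge ipP (@conv_grads_convex _ _ _ g x) pp (conv_grads_vertex g x i).
  by rewrite (ipBr ipP) (ip_norm ipP) (ipC ipP); lra.
have /choice[d dP] i : exists d, 0 < d /\ forall h, `|h| < d ->
    `|f i (x + h) - f i x - ip (g i x) h| <= `|p| / 2 * `|h|.
  exact: fg.
pose D := \big[Order.min/1]_(i < m) d i.
have D0 : 0 < D by apply: lt_bigmin => // i _; have [] := dP i.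
(* The displacement has length [D / 2], inside every radius [d i]; the remainder, with slope
   [|p| / 2], consumes at most half of the decrease [s * |p|^2]. *)
pose s := D / (2 * `|p|).
have s0 : 0 < s by rewrite divr_gt0// mulr_gt0.
exists (x + (- s) *: p) => i.
have sp : `|(- s) *: p| = s * `|p| by rewrite normrZ normrN gtr0_norm.
have := (dP i).2 ((- s) *: p); rewrite sp.
have : s * `|p| < d i.
  apply: lt_le_trans (bigmin_le 1 i d); rewrite -/D.
  by rewrite (_ : s * _ = D / 2); [lra|rewrite /s; field; rewrite gt_eqF].
move=> h /(_ h); rewrite (ipZr ipP) ler_norml => /andP[_ h1].
have h2 : s * `|p| ^+ 2 <= s * ip (g i x) p by rewrite ler_pM2l.
have : 0 < s * `|p| ^+ 2 by rewrite mulr_gt0// exprn_gt0.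
by lra.
Qed.

(* Convex functions are weakly lower semicontinuous, hence so is [merit_u0]. *)
Lemma weak_limit_weak_pareto (x : nat -> H) xs :
  (forall i, convex_fun (f i)) -> (forall i, has_gradient ip (f i) (g i)) ->
  (fun k => merit_u0 f (x k)) @ \oo --> 0%E ->
  (forall y, (fun k => ip (x k) y) @ \oo --> ip xs y) -> weak_pareto f xs.
Proof.
move=> cf fg u0 wk [z zlt].
pose D := \big[Order.min/1]_(i < m) (f i xs - f i z).
have D0 : 0 < D by apply: lt_bigmin => // i _; rewrite subr_gt0.
have D20 : 0 < D / 2 by lra.
have /fine_cvgP[ufin /cvgrPdist_lt/(_ _ D20) uD] := u0.
(* Weak convergence is tested on the finitely many gradients at [xs]. The gradient inequality then
   gives [f i (x k) - f i z >= D / 2] for every [i], against the vanishing merit. *)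
have gD : \forall k \near \oo, forall i, `|ip xs (g i xs) - ip (x k) (g i xs)| < D / 2.
  by apply: filter_forall => i; move/cvgrPdist_lt: (wk (g i xs)); exact.
have [k [[kfin ku] kg]] := filter_ex (filterI (filterI ufin uD) gD).
have : ((D / 2)%:E <= merit_u0 f (x k))%E.
  apply: (@merit_u0_ge _ _ _ f (x k) z) => i.
  have := convex_grad_le ipP xs (x k) (cf i) (fg i).
  rewrite (ipBr ipP) !(ipC ipP (g i xs)).
  have := kg i; rewrite ltr_norml => /andP[h1 h2].
  have := bigmin_le 1 i (fun i => f i xs - f i z); rewrite -/D.
  by lra.
rewrite -(fineK kfin) lee_fin; move: ku; rewrite /= sub0r normrN.
by move=> /(le_lt_trans (ler_norm _)); lra.
Qed.
End pareto.

(** The weak Pareto point below [y] may lie far from [x0], but the infimum in [R_const] runs over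
    its whole fibre under [Fval], which contains a point [z] near [x0] with the same values. *)
Lemma R_const_bounded (R : realType) (H : normedModType R) (m : nat)
    (f : 'I_m -> H -> R) (x0 : H) :
  (forall y, level_set f (Fval f x0) y ->
     exists xs, weak_pareto_level f (Fval f y) xs) ->
  (R_const f x0 < +oo)%E ->
  exists B, forall y, level_set f (Fval f x0) y ->
    exists z, 2^-1 * `|z - x0| ^+ 2 < B /\ forall i, f i z <= f i y.
Proof.
move=> wp Roo.
have [B RB] : exists B, (R_const f x0 < B%:E)%E.
  case: (R_const f x0) Roo => [r _| |_] //; last by exists 0; exact: ltNyr.
  by exists (r + 1); rewrite lte_fin; lra.
exists B => y yx0; have [xs [wxs xsy]] := wp y yx0.
have : (ereal_inf [set (2^-1 * `|x - x0| ^+ 2)%:E | x in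
    [set x | Fval f x = Fval f xs]] < B%:E)%E.
  apply: le_lt_trans RB; apply: ereal_sup_ubound; exists (Fval f xs) => //.
  by exists xs => //; split=> // i; apply: le_trans (xsy i) (yx0 i).
move=> /ereal_inf_lt[_ [z /= zxs <-]]; rewrite lte_fin => zB.
by exists z; split=> // i; have := congr1 (@^~ i) zxs; rewrite /Fval => ->; exact: xsy.
Qed.

(** * The integrating factor *)

Section power.
Context {R : realType} (alpha t0 : R) (t00 : 0 < t0).

(** This is [t ^ alpha] for positive [t]. *)
Definition rpow (t : R) : R := expR (alpha * ln t).

Lemma rpow_gt0 t : 0 < rpow t. Proof. exact: expR_gt0. Qed.

Lemma rpow_le s t : 0 < alpha -> 0 < s -> s <= t -> rpow s <= rpow t.
Proof.
by move=> a0 s0 st; rewrite ler_expR ler_pM2l// ler_ln// posrE// (lt_le_trans s0).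
Qed.

Lemma deriv_from_rpow : deriv_from t0 rpow (fun t => alpha / t * rpow t).
Proof.
move=> t t0t; apply: is_derive_derivative_from; rewrite mulrC.
have tgt0 : 0 < t := lt_le_trans t00 t0t.
have dln := is_derive1_ln tgt0.
exact: (@is_derive1_comp R expR (fun t => alpha * ln t)).
Qed.

Lemma locally_bounded_rpow : locally_bounded t0 (fun t => alpha / t * rpow t).
Proof.
move=> b.
have [M MP] := continuous_from_locally_bounded
  (deriv_from_continuous_from deriv_from_rpow) b.
exists (`|alpha| / t0 * M) => t tb; have /andP[t0t _] := tb.
have tgt0 : 0 < t := lt_le_trans t00 t0t.
rewrite normrM; apply: ler_pM => //; last exact: MP.
rewrite normrM normfV (gtr0_norm tgt0); apply: ler_wpM2l => //.
by rewrite lef_pV2 ?posrE.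
Qed.
End power.

(** * Energy and distance estimates along a trajectory *)

Section dynamics.
Context {R : realType} {H : normedModType R} {ip : H -> H -> R} {m : nat}.
Context {f : 'I_m -> H -> R} {g : 'I_m -> H -> H} {alpha t0 : R}.
Context {x xd xdd : R -> H}.
Context (ipP : inner_product ip) (cf : forall i, convex_fun (f i)).
Context (fg : forall i, has_gradient ip (f i) (g i)).
Context (cg : forall i, continuous (g i)).
Context (alpha0 : 0 < alpha) (t00 : 0 < t0) (dx : deriv_from t0 x xd).
Context (acxd : forall T, t0 <= T -> abs_cont_on t0 T xd).
Context (sol : {ae (@lebesgue_measure R), forall t, t0 < t ->
      is_derive t 1 xd (xdd t) /\
      proj_onto (shift_set (conv_grads g (x t)) (xdd t)) 0 (- ((alpha / t) *: xd t))}).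

(** The kinetic term is written with [ip] so that the bilinear rules apply to it. *)
Definition energy i t := f i (x t) + 2^-1 * ip (xd t) (xd t).

Lemma locally_bounded_xd : locally_bounded t0 xd.
Proof. exact/continuous_from_locally_bounded/abs_cont_continuous_from. Qed.

Lemma tame_xd T : tame t0 T xd xd.
Proof. exact: tame_self locally_bounded_xd. Qed.

Lemma tame_x T : tame t0 T xd x.
Proof. exact: tame_deriv_from dx locally_bounded_xd. Qed.

Lemma tame_fx i T : tame t0 T xd (f i \o x).
Proof.
apply: (@tame_deriv_from _ _ _ _ _ _ _ (fun t => ip (g i (x t)) (xd t))).
  by move=> t t0t; apply: (derivative_from_grad ipP (fg i)); exact: dx.
move=> b; have [M MP] := locally_bounded_xd b.
have [M' M'P] := continuous_from_locally_bounded
  (continuous_from_comp (deriv_from_continuous_from dx) (cg (i:=i))) b.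
exists (M' * M) => t tb; apply: le_trans (cauchy_schwarz ipP _ _) _.
by apply: ler_pM => //; [exact: M'P|exact: MP].
Qed.

Lemma tame_energy i T : tame t0 T xd (energy i).
Proof.
apply: tameD; first exact: tame_fx.
apply: (tame_bilinear bounded_bilinear_mul); first exact: tame_cst.
by apply: (tame_bilinear (bounded_bilinear_ip ipP)); exact: tame_xd.
Qed.

Lemma derivative_energy i t a : t0 <= t -> derivative_from t0 xd t a ->
  derivative_from t0 (energy i) t (ip (g i (x t)) (xd t) + ip (xd t) a).
Proof.
move=> t0t da; apply: derivative_fromD.
  exact: (derivative_from_grad ipP (fg i) (dx t0t)).
have := derivative_fromZ 2^-1
  (derivative_from_bilinear (bounded_bilinear_ip ipP) da da).
by rewrite (ipC ipP a) (_ : 2^-1 * _ = ip (xd t) a)//; field.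
Qed.

(** The variational inequality for the projection [- (alpha / t) xd], tested at the vertex
    [g i (x t) + a] and divided by [alpha / t]. *)
Lemma energy_decay i t a :
  proj_onto (shift_set (conv_grads g (x t)) a) 0 (- ((alpha / t) *: xd t)) ->
  0 < t ->
  ip (g i (x t)) (xd t) + ip (xd t) a <= - (alpha / t * ip (xd t) (xd t)).
Proof.
move=> pj tgt0.
have Kg : shift_set (conv_grads g (x t)) a (g i (x t) + a).
  by exists (g i (x t)) => //; exact: conv_grads_vertex.
have := proj_onto0_ge ipP (shift_set_convex (@conv_grads_convex _ _ _ g (x t))) pj Kg.
rewrite -scaleNr (ipZl ipP) (ipBr ipP) (ipDr ipP) (ipZr ipP).
rewrite mulNr oppr_ge0 pmulr_rle0 ?divr_gt0// (ipC ipP (g i _)).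
by lra.
Qed.

(* The acceleration equals [- (alpha / t) xd - \sum_i l i *: g i x] for a point
   [l] of the simplex; the gradient inequality bounds the last term. *)
Lemma acceleration_le z c t a :
  proj_onto (shift_set (conv_grads g (x t)) a) 0 (- ((alpha / t) *: xd t)) ->
  (forall i, c <= f i (x t) - f i z) ->
  ip (x t - z) a <= - (alpha / t * ip (x t - z) (xd t)) - c.
Proof.
move=> [[_ [l [l0 [l1 ->]]] ea] _] cz.
have -> : a = - ((alpha / t) *: xd t) - \sum_(i < m) l i *: g i (x t).
  by rewrite -ea addrAC subrr add0r.
rewrite (ipBr ipP) -scaleNr (ipZr ipP) mulNr lerD2l lerN2 (ipC ipP) (ip_suml ipP).
rewrite -[c]mul1r -l1 mulr_suml; apply: ler_sum => i _; apply: ler_wpM2l => //.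
apply: le_trans (cz i) _; have := convex_grad_le ipP (x t) z (cf i) (fg i).
by rewrite !(ipBr ipP); lra.
Qed.

(** A tame function inherits absolute continuity from [xd], so its derivative matters only at times
    where the equation holds. *)
Lemma tame_nonincreasing (phi : R -> R) s t : t0 <= s -> s <= t ->
  tame t0 t xd phi ->
  (forall r, s < r < t -> derivative_from t0 xd r (xdd r) ->
     proj_onto (shift_set (conv_grads g (x r)) (xdd r)) 0 (- ((alpha / r) *: xd r)) ->
     exists2 d, derivative_from t0 phi r d & d <= 0) ->
  phi t <= phi s.
Proof.
move=> t0s st tphi dphi; apply: (abs_cont_nonincreasing t0s st).
  move=> e e0; have [d [d0 dP]] := tame_abs_cont (acxd (le_trans t0s st)) tphi e0.
  exists d; split=> // n l r lr; apply: dP => k; have [? ?] := lr k.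
  by split=> //; lra.
have [N [mN N0 subN]] := sol; exists N; split=> // r nr; apply: subN.
apply: contra_not nr => rsol srt; have /andP[sr rt] := srt.
have [|dr pj] := rsol; first by lra.
by apply: dphi => //; exact: is_derive_derivative_from.
Qed.

Lemma energy_nonincreasing i s t : t0 <= s -> s <= t -> energy i t <= energy i s.
Proof.
move=> t0s st; apply: tame_nonincreasing => //; first exact: tame_energy.
move=> r /andP[sr rt] dr pj; have r0 : 0 < r by apply: lt_le_trans t00 _; lra.
exists (ip (g i (x r)) (xd r) + ip (xd r) (xdd r)).
  by apply: derivative_energy => //; lra.
apply: le_trans (energy_decay i pj r0) _.
by rewrite oppr_le0 mulr_ge0 ?(ip_norm ipP) ?sqr_ge0// divr_ge0// ltW.
Qed.

(** Chosen so that [K * alpha = 3 / 2]: the decay of [K] times the energy then cancels the kinetic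
    term [3 / 2 |xd|^2]. *)
Let K := 3 / (2 * alpha).

(* [Phi] adds to [t ^ alpha h'(t)], with [h = |x - z|^2 / 2], the energy as an
   antiderivative of [- (alpha / t) |xd|^2], which absorbs the kinetic term. *)
Lemma momentum_bound i z eps eta c Einf A t1 tau : t0 <= t1 -> t1 <= tau ->
  (forall j, eps <= energy j tau - f j z) ->
  (forall t, t1 <= t <= tau -> Einf <= energy i t <= Einf + eta) ->
  (1 + alpha) * (K * eta + c) <= eps -> 0 <= A ->
  ip (x t1 - z) (xd t1) + t1 * (K * eta + c) <= A ->
  forall t, t1 <= t <= tau -> ip (x t - z) (xd t) <= A - c * t.
Proof.
move=> t0t1 t1tau epsz Ei Keta A0 hA t /andP[t1t ttau].
have K0 : 0 < K by rewrite /K divr_gt0// mulr_gt0.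
have Ka : K * alpha = 3 / 2 by rewrite /K; field; rewrite gt_eqF.
pose hp s := ip (x s - z) (xd s).
(* Equal to [K * (energy i s - Einf) + c], hence between [c] and [K * eta + c] on [[t1, tau]]. *)
pose w s := K * energy i s + (c - K * Einf).
pose Phi s := rpow alpha s * hp s + (s * rpow alpha s) * w s.
have Phi_le : Phi t <= Phi t1.
  apply: tame_nonincreasing => //.
    have trpow : tame t0 t xd (rpow alpha).
      exact: tame_deriv_from (deriv_from_rpow alpha t00) (locally_bounded_rpow alpha t00).
    apply: tameD; apply: (tame_bilinear bounded_bilinear_mul) => //.
    - apply: (tame_bilinear (bounded_bilinear_ip ipP)); last exact: tame_xd.
      by apply: tameD; [exact: tame_x|exact: tame_cst].
    - by apply: (tame_bilinear bounded_bilinear_mul) => //; exact: tame_id.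
    - apply: tameD; last exact: tame_cst.
      apply: (tame_bilinear bounded_bilinear_mul); first exact: tame_cst.
      exact: tame_energy.
  move=> r /andP[t1r rt] dr pj.
  have r0 : 0 < r by apply: lt_le_trans t00 _; lra.
  have t0r : t0 <= r by lra.
  have drpow := deriv_from_rpow alpha t00 t0r.
  have dxz : derivative_from t0 (fun s => x s - z) r (xd r).
    have := derivative_fromD (dx t0r) (derivative_from_cst t0 (- z) r).
    by rewrite addr0.
  have dhp := derivative_from_bilinear (bounded_bilinear_ip ipP) dxz dr.
  have dw := derivative_fromD (derivative_fromZ K (derivative_energy i t0r dr))
    (derivative_from_cst t0 (c - K * Einf) r).
  have dPhi := derivative_fromD (derivative_fromM drpow dhp)
    (derivative_fromM (derivative_fromM (derivative_from_id t0 r) drpow) dw).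
  eexists; first exact: dPhi.
  (* Since energies decrease, the gap at [tau] persists at the earlier time [r], up to the kinetic
     energy at [r]. *)
  have Er : forall j, eps - 2^-1 * ip (xd r) (xd r) <= f j (x r) - f j z.
    move=> j; have := epsz j; have := @energy_nonincreasing j r tau t0r.
    by rewrite {2}/energy => /(_ _)h ?; have := h _; lra.
  have /andP[_ Ee] : Einf <= energy i r <= Einf + eta.
    by apply: Ei; apply/andP; split; lra.
  have aX := acceleration_le pj Er; have aE := energy_decay i pj r0.
  have rq : r * (alpha / r) = alpha by field; rewrite gt_eqF.
  have P0 := rpow_gt0 alpha r.
  move: (alpha / r) rq aX aE => q rq aX aE.
  set P := rpow alpha r; set v := ip (xd r) (xd r) in Er aX aE *.
  set dE := ip (g i (x r)) (xd r) + _ in aE *; set X := ip (x r - z) (xdd r) in aX *.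
  (* The factor [1 + alpha] comes from differentiating [s * rpow alpha s], using
     [r * (alpha / r) = alpha]. *)
  rewrite [leLHS](_ : _ = P * (q * hp r + v + X +
    (1 + alpha) * (K * energy i r + (c - K * Einf)) + r * (K * dE))); last first.
    by rewrite -rq /hp; ring.
  rewrite pmulr_rle0//.
  have w1 : (1 + alpha) * (K * energy i r + (c - K * Einf)) <=
      (1 + alpha) * (K * eta + c).
    rewrite ler_pM2l; last exact: addr_gt0.
    have : K * energy i r <= K * (Einf + eta) by rewrite ler_pM2l.
    by lra.
  have w2 : r * (K * dE) <= - (3 / 2 * v).
    rewrite -Ka -rq (_ : - _ = r * (K * - (q * v))); last by ring.
    by rewrite !ler_pM2l.
  by rewrite /hp; lra.
have p0 := rpow_gt0 alpha t.
have p10 := rpow_gt0 alpha t1.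
have t10 : 0 < t1 := lt_le_trans t00 t0t1.
have p1p : rpow alpha t1 <= rpow alpha t by exact: rpow_le.
have /andP[Et _] : Einf <= energy i t <= Einf + eta by apply: Ei; rewrite t1t.
have /andP[_ Et1] : Einf <= energy i t1 <= Einf + eta by apply: Ei; rewrite lexx.
have h1 : rpow alpha t * (hp t + c * t) <= Phi t.
  have : 0 <= (t * rpow alpha t) * (K * (energy i t - Einf)).
    apply: mulr_ge0; first by apply: mulr_ge0; [lra|exact: ltW].
    by apply: mulr_ge0; [exact: ltW|lra].
  by rewrite /Phi /w; lra.
have h2 : Phi t1 <= rpow alpha t1 * A.
  have : 0 <= (t1 * rpow alpha t1) * (K * (Einf + eta - energy i t1)).
    apply: mulr_ge0; first by apply: mulr_ge0; exact: ltW.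
    by apply: mulr_ge0; [exact: ltW|lra].
  have : rpow alpha t1 * (ip (x t1 - z) (xd t1) + t1 * (K * eta + c)) <=
     rpow alpha t1 * A by rewrite ler_pM2l.
  by rewrite /Phi /w /hp; lra.
(* The sign of [A] matters here: it lets the larger weight at [t] replace the one at [t1]. *)
have h3 : rpow alpha t1 * A <= rpow alpha t * A by rewrite ler_wpM2r.
have : rpow alpha t * (hp t + c * t) <= rpow alpha t * A by lra.
by rewrite ler_pM2l// /hp; lra.
Qed.

(** The momentum bound says that [2^-1 * |x - z|^2], plus the antiderivative [s * (c / 2 * s - A)]
    of [c * s - A], is nonincreasing. *)
Lemma distance_bound z c A t1 tau : t0 <= t1 -> t1 <= tau ->
  (forall t, t1 <= t <= tau -> ip (x t - z) (xd t) <= A - c * t) ->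
  2^-1 * `|x tau - z| ^+ 2 <=
    2^-1 * `|x t1 - z| ^+ 2 + A * (tau - t1) - c / 2 * (tau ^+ 2 - t1 ^+ 2).
Proof.
move=> t0t1 t1tau hp.
pose G s := 2^-1 * ip (x s - z) (x s - z) + s * (c / 2 * s + - A).
suff : G tau <= G t1 by rewrite /G !(ip_norm ipP); lra.
have tid := tame_id t0 tau xd.
have txz : tame t0 tau xd (fun s => x s - z).
  by apply: tameD; [exact: tame_x|exact: tame_cst].
apply: tame_nonincreasing => //.
  apply: tameD; apply: (tame_bilinear bounded_bilinear_mul) => //.
  - exact: tame_cst.
  - exact: (tame_bilinear (bounded_bilinear_ip ipP)).
  - apply: tameD; last exact: tame_cst.
    by apply: (tame_bilinear bounded_bilinear_mul) => //; exact: tame_cst.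
move=> r /andP[t1r rt] dr pj.
have t0r : t0 <= r by lra.
have dxz : derivative_from t0 (fun s => x s - z) r (xd r).
  have := derivative_fromD (dx t0r) (derivative_from_cst t0 (- z) r).
  by rewrite addr0.
have did := derivative_from_id t0 r.
have := derivative_fromD (derivative_fromZ 2^-1
    (derivative_from_bilinear (bounded_bilinear_ip ipP) dxz dxz))
  (derivative_fromM did (derivative_fromD (derivative_fromZ (c / 2) did)
    (derivative_from_cst t0 (- A) r))).
move=> dG; eexists; first exact: dG.
have := hp r; rewrite (ltW t1r) (ltW rt) => /(_ isT).
by rewrite (ipC ipP (xd r)); lra.
Qed.

Lemma lyapunov_small x0 (i : 'I_m) B eps :
  (exists c, forall z, c <= f i z) ->
  (forall y, level_set f (Fval f x0) y ->
    exists z, 2^-1 * `|z - x0| ^+ 2 < B /\ forall j, f j z <= f j y) ->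
  x t0 = x0 -> xd t0 = 0 -> 0 < eps ->
  exists T, forall tau, T <= tau ->
    (merit_u0 f (x tau) + (2^-1 * `|xd tau| ^+ 2)%:E <= eps%:E)%E.
Proof.
move=> [fmin fminP] Bz xt0 xdt0 eps0.
have K0 : 0 < K by rewrite /K divr_gt0// mulr_gt0.
have a10 : 0 < 1 + alpha by exact: addr_gt0.
(* [c] and [K * eta] each receive half of [eps / (1 + alpha)], which turns the smallness condition
   of [momentum_bound] into an equality. *)
pose c := eps / (2 * (1 + alpha)).
have c0 : 0 < c by rewrite divr_gt0// mulr_gt0.
pose eta := c / K.
have eta0 : 0 < eta by exact: divr_gt0.
have Ketac : (1 + alpha) * (K * eta + c) = eps.
  by rewrite /eta /c; field; rewrite !gt_eqF.
(* The energy is nonincreasing and bounded below, so from some [t1] on it stays within [eta] of its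
   infimum. *)
pose S := [set energy i t | t in [set t | t0 <= t]].
have Sinf : has_inf S.
  split; first by exists (energy i t0), t0 => //=.
  exists fmin => _ [t _ <-]; rewrite /energy (ip_norm ipP).
  by have := fminP (x t); have := sqr_ge0 `|xd t|; lra.
have [_ [t1 /= t0t1 <-] Et1] := inf_adherent eta0 Sinf.
have Ei t : t1 <= t -> inf S <= energy i t <= inf S + eta.
  move=> t1t; apply/andP; split.
    by apply: ge_inf; [exact: Sinf.2|exists t => //=; lra].
  by apply: le_trans (ltW Et1); exact: energy_nonincreasing.
have t10 : 0 < t1 := lt_le_trans t00 t0t1.
(* By the parallelogram identity [B1] dominates [2^-1 * |x t1 - z|^2] for every [z] in the ball, and
   [A] then follows from [young]. Neither depends on [tau] or [z]. *)
pose B1 := `|x t1 - x0| ^+ 2 + 2 * Num.max B 0.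
pose A := B1 + 2^-1 * `|xd t1| ^+ 2 + t1 * (K * eta + c).
have B10 : 0 <= B1 by rewrite addr_ge0 ?sqr_ge0// mulr_ge0// le_max lexx orbT.
have Kc0 : 0 < K * eta + c by rewrite addr_gt0// mulr_gt0.
have A0 : 0 <= A.
  have := mulr_ge0 (ltW t10) (ltW Kc0); have := sqr_ge0 `|xd t1|.
  by rewrite /A; lra.
(* From [tau >= 2 * D / c] follows [c / 2 * tau - A >= B1 + c / 2 * t1 ^+ 2 + 1]; multiplying the
   left side by [tau >= 1] makes the bound of [distance_bound] negative. *)
pose D := A + B1 + c / 2 * t1 ^+ 2 + 1.
exists (Num.max (Num.max t1 1) (2 * D / c)) => tau.
rewrite !ge_max => /andP[/andP[t1tau tau1]]; rewrite ler_pdivrMr// => Dtau.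
rewrite leNgt; apply/negP; rewrite -lteBlDr// -EFinB => /merit_u0_gt[y yP].
have ytau j : f j y < energy j tau - eps.
  by have := yP j; rewrite /energy (ip_norm ipP); lra.
(* The initial velocity vanishes, so the energies start at the values [f j x0]. *)
have yx0 : level_set f (Fval f x0) y.
  move=> j; have := @energy_nonincreasing j t0 tau (lexx t0) (le_trans t0t1 t1tau).
  have := ytau j; rewrite /Fval {3}/energy xt0 xdt0 (ip0l ipP); lra.
have [z [zB zy]] := Bz y yx0.
have epsz j : eps <= energy j tau - f j z.
  by have := ytau j; have := zy j; lra.
have zB1 : 2^-1 * `|x t1 - z| ^+ 2 <= B1.
  have := norm_add_scale ipP (x t1 - x0) (z - x0) (-1).
  have -> : x t1 - x0 + -1 *: (z - x0) = x t1 - z.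
    by rewrite scaleN1r opprB addrA subrK.
  move=> ->; have := sqr_ge0 `|x t1 - x0 + 1 *: (z - x0)|.
  rewrite (norm_add_scale ipP) /B1.
  have : B <= Num.max B 0 by rewrite le_max lexx.
  by lra.
have hA : ip (x t1 - z) (xd t1) + t1 * (K * eta + c) <= A.
  by have := young ipP (x t1 - z) (xd t1); rewrite /A; lra.
have Eit t : t1 <= t <= tau -> inf S <= energy i t <= inf S + eta.
  by move=> /andP[/Ei].
have Keta : (1 + alpha) * (K * eta + c) <= eps by rewrite Ketac.
have := distance_bound t0t1 t1tau (momentum_bound t0t1 t1tau epsz Eit Keta A0 hA).
have h0 : 0 <= `|x tau - z| ^+ 2 by exact: sqr_ge0.
have At1 : 0 <= A * t1 by rewrite mulr_ge0// ltW.
have h1 : (c / 2 * tau - A) * 1 <= (c / 2 * tau - A) * tau.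
  rewrite ler_wpM2l//.
  have : 0 <= c / 2 * t1 ^+ 2 by rewrite mulr_ge0 ?sqr_ge0//; lra.
  by move: Dtau; rewrite /D; lra.
by move: Dtau; rewrite /D; lra.
Qed.

End dynamics.

Theorem theorem4p7 (R : realType) (H : completeNormedModType R) (ip : H -> H -> R)
  (m : nat) (f : 'I_m -> H -> R) (g : 'I_m -> H -> H)
  (alpha t0 : R) (x0 : H) (x xd xdd : R -> H) :
  inner_product ip ->
  (0 < m)%N ->
  (forall i, convex_fun (f i)) ->
  (forall i, has_gradient ip (f i) (g i)) ->
  (forall i, continuous (g i)) ->
  (forall i, exists c : R, forall z, c <= f i z) ->
  (forall x0' : H, forall y, level_set f (Fval f x0') y ->
     exists xs, weak_pareto_level f (Fval f y) xs) ->
  (R_const f x0 < +oo)%E ->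
  0 < alpha -> 0 < t0 ->
  (* x is a solution of the Cauchy problem *)
  deriv_from t0 x xd ->
  {within [set t | t0 <= t], continuous xd} ->
  (forall T, t0 <= T -> abs_cont_on t0 T xd) ->
  {ae (@lebesgue_measure R), forall t, t0 < t ->
      is_derive t 1 xd (xdd t) /\
      proj_onto (shift_set (conv_grads g (x t)) (xdd t)) 0 (- ((alpha / t) *: xd t))} ->
  x t0 = x0 -> xd t0 = 0 ->
  let W := fun t => (merit_u0 f (x t) + ((2^-1) * `|xd t| ^+ 2)%:E)%E in
  [/\ W @ +oo --> 0%E,
      (fun t => merit_u0 f (x t)) @ +oo --> 0%E
    & forall xs : H, (exists tk : nat -> R, tk @ \oo --> +oo /\
          forall y : H, (fun k => ip (x (tk k)) y) @ \oo --> ip xs y) ->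
        pareto_critical g xs].
Proof.
move=> ipP m0 cf fg cg fmin wp Roo alpha0 t00 dx _ acxd sol xt0 xdt0 W.
have [B BP] := R_const_bounded (wp x0) Roo.
have Wle e : 0 < e -> exists T, forall t, T <= t -> (W t <= e%:E)%E.
  exact: (lyapunov_small ipP cf fg cg alpha0 t00 dx acxd sol (fmin (Ordinal m0)) BP).
have kin0 t : (0 <= (2^-1 * `|xd t| ^+ 2)%:E)%E.
  by rewrite lee_fin mulr_ge0 ?sqr_ge0// invr_ge0.
have u0cvg : (fun t => merit_u0 f (x t)) @ +oo --> 0%E.
  apply: cvge0_pinfty => [t|e /Wle[T TP]]; first exact: merit_u0_ge0.
  by exists T => t /TP; apply: le_trans; rewrite leeDl.
split=> //; first by apply: cvge0_pinfty => // t; rewrite adde_ge0// merit_u0_ge0.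
move=> xs [tk [tkoo wk]]; apply: (weak_pareto_critical ipP m0 fg).
by apply: (weak_limit_weak_pareto ipP cf fg) wk; exact: cvg_comp tkoo u0cvg.
Qed.
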